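(* Let $P$ be an arbitrary set, let $\mathcal{L}^L\mathcal{S}^{co}$ be the category of the left strong comonad freely generated by $P$ as set of generating objects, and let $\Delta^{op}$ be the opposite of the simplicial category $\Delta$. Then the functor $G:\mathcal{L}^L\mathcal{S}^{co}\to\Delta^{op}$ defined in the context is faithful; i.e. for all objects $A,B$ and all arrows $f,g:A\to B$ of $\mathcal{L}^L\mathcal{S}^{co}$, if $Gf=Gg$, then $f=g$.
   Context: A monoidal category has a bifunctor $\otimes$, a unit object $I$ and natural isomorphisms $a_{A,B,C}:(A\otimes B)\otimes C\to A\otimes(B\otimes C)$, $l_A:I\otimes A\to A$, $r_A:A\otimes I\to A$ satisfying the usual coherence conditions. $\mathbf 1_A$ denotes the identity arrow of $A$. A left strong comonad in a monoidal category $\mathcal A$ is a comonad $\langle L,\varepsilon,\delta\rangle$ in $\mathcal A$ (with $\varepsilon_A:LA\to A$, $\delta_A:LA\to LLA$) together with a natural transformation with components $\psi^L_{A,B}:LA\otimes B\to L(A\otimes B)$ such that - $La_{A,B,C}\circ\psi^L_{A\otimes B,C}\circ(\psi^L_{A,B}\otimes\mathbf 1_C)=\psi^L_{A,B\otimes C}\circ a_{LA,B,C}$, - $Lr_A\circ\psi^L_{A,I}=r_{LA}$, - $\varepsilon_{A\otimes B}\circ\psi^L_{A,B}=\varepsilon_A\otimes\mathbf 1_B$, - $\delta_{A\otimes B}\circ\psi^L_{A,B}=L\psi^L_{A,B}\circ\psi^L_{LA,B}\circ(\delta_A\otimes\mathbf 1_B)$. $\mathcal{L}^L\mathcal{S}^{co}$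 is the free such structure on $P$: its objects are the formal expressions built from elements of $P$ and $I$ by $\otimes$ and $L$; its arrows are arrow terms built from identities, $a,a^{-1},l,l^{-1},r,r^{-1},\varepsilon,\delta,\psi^L$ by $\circ$, $\otimes$ and $L$, modulo the congruence generated by the equations of categories, functoriality, naturality, monoidal categories, comonads, and the four equations above. $\Delta$ is the category whose objects are the finite ordinals $n=\{0,\dots,n-1\}$ and whose arrows are the order-preserving (i.e. weakly monotone) functions. An arrow $n\to m$ of $\Delta^{op}$ is an order-preserving function $m\to n$. The functor $G$: $GA$ is the number of occurrences of $L$ in $A$; the elements $0,\dots,GA-1$ of $GA$ correspond to the occurrences of $L$ in $A$ counted from right to left. On arrow terms: $G$ of an identity, of $a_{A,B,C}$, $l_A$, $r_A$ and their inverses, and of $\psi^L_{A,B}$ is the identity; $G\varepsilon_A:GA+1\to GA$ in $\Delta^{op}$ is given by the function $GA\to GA+1$, $i\mapsto i$; $G\delta_A:GA+1\to GA+2$ in $\Delta^{op}$ is given by the function $GA+2\to GA+1$ with $i\mapsto i$ for $i\le GA$ and $GA+1\mapsto GA$; $G(f\otimes g)$ is the juxtaposition of $Gf$ (on the left, i.e. on the larger elements) and $Gg$ (on the right, i.e. on the smaller elements); $GLf$ extends $Gf$ by linking the new leftmost (greatest) element of the source with the new leftmost (greatest) element of the target; $G(g\circ f)=Gg\circ Gf$ in $\Delta^{op}$. *)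

(* Defs.v *)
(* Written in MathComp; the classical axioms of boolp are used to form hom-sets
   as quotients of arrow terms. *)
From HB Require Import structures.
From mathcomp Require Import all_boot.
From mathcomp Require Import boolp.
From mathcomp Require Import zify.

Set Implicit Arguments.
Unset Strict Implicit.
Unset Printing Implicit Defensive.

Local Open Scope quotient_scope.

Record category := Category {
  obj :> Type;
  hom : obj -> obj -> Type;
  idc : forall A, hom A A;
  compc : forall A B C, hom B C -> hom A B -> hom A C;
  compc1 : forall A B (f : hom A B), compc f (idc A) = f;
  comp1c : forall A B (f : hom A B), compc (idc B) f = f;
  compcA : forall A B C D (h : hom C D) (g : hom B C) (f : hom A B),
    compc h (compc g f) = compc (compc h g) f
}.

Definition op (C : category) : category :=
  @Category C (fun A B => hom B A) (@idc C) (fun A B D g f => compc f g)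
    (fun A B f => comp1c f) (fun A B f => compc1 f)
    (fun A B D E h g f => esym (compcA f g h)).

Record functor (C D : category) := Functor {
  fobj :> C -> D;
  fmap : forall A B, hom A B -> hom (fobj A) (fobj B);
  fmap1 : forall A, fmap (idc A) = idc (fobj A);
  fmapM : forall A B E (g : hom B E) (f : hom A B),
    fmap (compc g f) = compc (fmap g) (fmap f)
}.

Definition faithful (C D : category) (F : functor C D) : Prop :=
  forall (A B : C) (f g : hom A B), fmap F f = fmap F g -> f = g.

Record monofun (m n : nat) := Monofun {
  ffun_of_monofun :> {ffun 'I_m -> 'I_n};
  monofun_subproof :
    [forall i : 'I_m, forall j : 'I_m,
      (i <= j) ==> (ffun_of_monofun i <= ffun_of_monofun j)]
}.

HB.instance Definition _ m n := [isSub for @ffun_of_monofun m n].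

Lemma mono_ffunP m n (f : 'I_m -> 'I_n) :
    (forall i j : 'I_m, i <= j -> f i <= f j) ->
  [forall i : 'I_m, forall j : 'I_m, (i <= j) ==> (finfun f i <= finfun f j)].
Proof.
move=> Hf; apply/forallP => i; apply/forallP => j; apply/implyP => ij.
by rewrite !ffunE; apply: Hf.
Qed.

Definition mkmono m n (f : 'I_m -> 'I_n)
    (Hf : forall i j : 'I_m, i <= j -> f i <= f j) : monofun m n :=
  Monofun (mono_ffunP Hf).

Lemma mkmonoE m n (f : 'I_m -> 'I_n) Hf i : @mkmono m n f Hf i = f i.
Proof. by rewrite ffunE. Qed.

Lemma monofunP m n (f : monofun m n) (i j : 'I_m) : i <= j -> f i <= f j.
Proof.
by case: f => f /= /forallP/(_ i)/forallP/(_ j)/implyP.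
Qed.

Lemma monofun_ext m n (f g : monofun m n) :
  (forall i, f i = g i :> nat) -> f = g.
Proof. by move=> fg; apply/val_inj/ffunP => i; apply/val_inj/fg. Qed.

Definition mono1 n : monofun n n := @mkmono n n id (fun i j ij => ij).

Lemma mcomp_subproof m n p (g : monofun n p) (f : monofun m n) (i j : 'I_m) :
  i <= j -> g (f i) <= g (f j).
Proof. by move=> ij; do 2 apply: monofunP. Qed.

Definition mcomp m n p (g : monofun n p) (f : monofun m n) : monofun m p :=
  mkmono (mcomp_subproof g f).

Lemma mcomp1 m n (f : monofun m n) : mcomp f (mono1 m) = f.
Proof. by apply: monofun_ext => i; rewrite !mkmonoE. Qed.

Lemma m1comp m n (f : monofun m n) : mcomp (mono1 n) f = f.
Proof. by apply: monofun_ext => i; rewrite !mkmonoE. Qed.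

Lemma mcompA m n p q (h : monofun p q) (g : monofun n p) (f : monofun m n) :
  mcomp h (mcomp g f) = mcomp (mcomp h g) f.
Proof. by apply: monofun_ext => i; rewrite !mkmonoE. Qed.

Definition Delta : category := Category mcomp1 m1comp mcompA.

(* The map i |-> i, when m and n are equal but not necessarily convertible. *)
Definition mcast m n (e : m = n) : monofun m n :=
  @mkmono m n (cast_ord e) (fun i j ij => ij).

Definition mface n : monofun n n.+1 :=
  @mkmono n n.+1 (widen_ord (leqnSn n)) (fun i j ij => ij).

Lemma mdegen_subproof n (i j : 'I_n.+2) : i <= j ->
  (inord (if i <= n then i : nat else n) : 'I_n.+1) <=
  (inord (if j <= n then j : nat else n) : 'I_n.+1).
Proof.
move=> ij; rewrite !inordK; have := ltn_ord i; have := ltn_ord j;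
  by case: (leqP i n); case: (leqP j n); lia.
Qed.

Definition mdegen n : monofun n.+2 n.+1 := mkmono (@mdegen_subproof n).

(* g acts on the smaller elements and f on the larger ones. *)
Definition juxt m n m' n' (f : 'I_m -> 'I_n) (g : 'I_m' -> 'I_n')
    (i : 'I_(m' + m)) : 'I_(n' + n) :=
  match split i with
  | inl j => lshift n (g j)
  | inr j => rshift n' (f j)
  end.

Lemma mjuxt_subproof m n m' n' (f : monofun m n) (g : monofun m' n')
    (i j : 'I_(m' + m)) : i <= j -> juxt f g i <= juxt f g j.
Proof.
rewrite /juxt; case: (splitP i) => i' ->; case: (splitP j) => j' -> /= ij.
- exact: monofunP.
- by rewrite (leq_trans (ltnW (ltn_ord _))) ?leq_addr.
- by move: (ltn_ord j'); rewrite ltnNge (leq_trans (leq_addr _ _) ij).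
- by rewrite leq_add2l; apply: monofunP; rewrite -(leq_add2l m').
Qed.

Definition mjuxt m n m' n' (f : monofun m n) (g : monofun m' n') :
  monofun (m' + m) (n' + n) := mkmono (mjuxt_subproof f g).

(* f extended by sending the greatest element to the greatest element. *)
Definition addtop m n (f : 'I_m -> 'I_n) (i : 'I_m.+1) : 'I_n.+1 :=
  if unlift ord_max i is Some j then lift ord_max (f j) else ord_max.

Lemma val_addtop m n (f : 'I_m -> 'I_n) (i : 'I_m.+1) :
  addtop f i = (if insub (i : nat) is Some j then f j : nat else n) :> nat.
Proof.
rewrite /addtop; case: unliftP => [j|] ->; last by rewrite insubN //= ltnn.
by rewrite !lift_max insubT //= => lt_jm; congr (_ (f _)); apply: val_inj.
Qed.

Lemma maddtop_subproof m n (f : monofun m n) (i j : 'I_m.+1) :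
  i <= j -> addtop f i <= addtop f j.
Proof.
rewrite !val_addtop; case: insubP => [i' _ <-|Hi]; case: insubP => [j' _ <-|Hj].
- exact: monofunP.
- by move=> _; apply: ltnW.
- by move=> ij; move: Hi; rewrite (leq_ltn_trans ij (ltn_ord j')).
- by [].
Qed.

Definition maddtop m n (f : monofun m n) : monofun m.+1 n.+1 :=
  mkmono (maddtop_subproof f).

Inductive fob (P : Type) : Type :=
| Gen of P
| Unit
| Tens of fob P & fob P
| Lob of fob P.

Arguments Unit {P}.

Declare Scope lsc_scope.
Delimit Scope lsc_scope with lsc.
Local Open Scope lsc_scope.

Local Notation "A ⊗ B" := (Tens A B)
  (at level 40, left associativity) : lsc_scope.

Inductive term (P : Type) : fob P -> fob P -> Type :=
| One A : term A A
| Comp A B C of term B C & term A B : term A C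
| TensM A A' B B' of term A A' & term B B' : term (A ⊗ B) (A' ⊗ B')
| LM A B of term A B : term (Lob A) (Lob B)
| Ass A B C : term ((A ⊗ B) ⊗ C) (A ⊗ (B ⊗ C))
| AssI A B C : term (A ⊗ (B ⊗ C)) ((A ⊗ B) ⊗ C)
| LU A : term (Unit ⊗ A) A
| LUI A : term A (Unit ⊗ A)
| RU A : term (A ⊗ Unit) A
| RUI A : term A (A ⊗ Unit)
| Eps A : term (Lob A) A
| Del A : term (Lob A) (Lob (Lob A))
| Psi A B : term (Lob A ⊗ B) (Lob (A ⊗ B)).

Arguments One {P} A.
Arguments Ass {P} A B C.
Arguments AssI {P} A B C.
Arguments LU {P} A.
Arguments LUI {P} A.
Arguments RU {P} A.
Arguments RUI {P} A.
Arguments Eps {P} A.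
Arguments Del {P} A.
Arguments Psi {P} A B.

Local Notation "g ∘ f" := (Comp g f)
  (at level 45, right associativity) : lsc_scope.
Local Notation "f ⊗₁ g" := (TensM f g)
  (at level 40, left associativity) : lsc_scope.

Reserved Notation "f === g" (at level 70, no associativity).

(* Naturality of the inverses AssI, LUI, RUI and the other coherence equations,
   such as LU Unit === RU Unit, follow from those listed. *)
Inductive eqterm (P : Type) : forall A B : fob P, term A B -> term A B -> Prop :=
| eqterm_refl A B (f : term A B) : f === f
| eqterm_sym A B (f g : term A B) : f === g -> g === f
| eqterm_trans A B (f g h : term A B) : f === g -> g === h -> f === h
| eqterm_Comp A B C (g g' : term B C) (f f' : term A B) :
    g === g' -> f === f' -> g ∘ f === g' ∘ f'
| eqterm_TensM A A' B B' (f f' : term A A') (g g' : term B B') :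
    f === f' -> g === g' -> f ⊗₁ g === f' ⊗₁ g'
| eqterm_LM A B (f f' : term A B) : f === f' -> LM f === LM f'
| cat_1r A B (f : term A B) : f ∘ One A === f
| cat_1l A B (f : term A B) : One B ∘ f === f
| cat_A A B C D (h : term C D) (g : term B C) (f : term A B) :
    h ∘ (g ∘ f) === (h ∘ g) ∘ f
| tens_1 A B : One A ⊗₁ One B === One (A ⊗ B)
| tens_M A A' A'' B B' B'' (f' : term A' A'') (f : term A A')
    (g' : term B' B'') (g : term B B') :
    (f' ∘ f) ⊗₁ (g' ∘ g) === (f' ⊗₁ g') ∘ (f ⊗₁ g)
| L_1 A : LM (One A) === One (Lob A)
| L_M A B C (g : term B C) (f : term A B) : LM (g ∘ f) === LM g ∘ LM f
| Ass_nat A A' B B' C C' (f : term A A') (g : term B B') (h : term C C') :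
    Ass A' B' C' ∘ ((f ⊗₁ g) ⊗₁ h) === (f ⊗₁ (g ⊗₁ h)) ∘ Ass A B C
| LU_nat A B (f : term A B) : LU B ∘ (One Unit ⊗₁ f) === f ∘ LU A
| RU_nat A B (f : term A B) : RU B ∘ (f ⊗₁ One Unit) === f ∘ RU A
| Eps_nat A B (f : term A B) : Eps B ∘ LM f === f ∘ Eps A
| Del_nat A B (f : term A B) : Del B ∘ LM f === LM (LM f) ∘ Del A
| Psi_nat A A' B B' (f : term A A') (g : term B B') :
    Psi A' B' ∘ (LM f ⊗₁ g) === LM (f ⊗₁ g) ∘ Psi A B
| Ass_AssI A B C : Ass A B C ∘ AssI A B C === One (A ⊗ (B ⊗ C))
| AssI_Ass A B C : AssI A B C ∘ Ass A B C === One ((A ⊗ B) ⊗ C)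
| LU_LUI A : LU A ∘ LUI A === One A
| LUI_LU A : LUI A ∘ LU A === One (Unit ⊗ A)
| RU_RUI A : RU A ∘ RUI A === One A
| RUI_RU A : RUI A ∘ RU A === One (A ⊗ Unit)
| pentagon A B C D :
    Ass A B (C ⊗ D) ∘ Ass (A ⊗ B) C D
    === (One A ⊗₁ Ass B C D) ∘ Ass A (B ⊗ C) D ∘ (Ass A B C ⊗₁ One D)
| triangle A B : (One A ⊗₁ LU B) ∘ Ass A Unit B === RU A ⊗₁ One B
| Eps_Del A : Eps (Lob A) ∘ Del A === One (Lob A)
| LEps_Del A : LM (Eps A) ∘ Del A === One (Lob A)
| Del_Del A : Del (Lob A) ∘ Del A === LM (Del A) ∘ Del A
| Psi_Ass A B C :
    LM (Ass A B C) ∘ Psi (A ⊗ B) C ∘ (Psi A B ⊗₁ One C)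
    === Psi A (B ⊗ C) ∘ Ass (Lob A) B C
| Psi_RU A : LM (RU A) ∘ Psi A Unit === RU (Lob A)
| Psi_Eps A B : Eps (A ⊗ B) ∘ Psi A B === Eps A ⊗₁ One B
| Psi_Del A B :
    Del (A ⊗ B) ∘ Psi A B === LM (Psi A B) ∘ Psi (Lob A) B ∘ (Del A ⊗₁ One B)
where "f === g" := (eqterm f g) : lsc_scope.

Section Quotient.
Variables (P : Type) (A B : fob P).

HB.instance Definition _ := gen_eqMixin (term A B).
HB.instance Definition _ := gen_choiceMixin (term A B).

Definition eqtermb (f g : term A B) : bool := `[< f === g >].

Lemma eqtermb_refl : reflexive eqtermb.
Proof. by move=> f; apply/asboolP; apply: eqterm_refl. Qed.

Lemma eqtermb_sym : symmetric eqtermb.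
Proof. by move=> f g; apply/asboolP/asboolP; apply: eqterm_sym. Qed.

Lemma eqtermb_trans : transitive eqtermb.
Proof.
move=> g f h /asboolP fg /asboolP gh; apply/asboolP; exact: eqterm_trans fg gh.
Qed.

Canonical eqterm_equiv := EquivRel eqtermb eqtermb_refl eqtermb_sym eqtermb_trans.

Definition arrow := {eq_quot eqterm_equiv}.

Definition arrow_of (f : term A B) : arrow := \pi_arrow f.

Lemma arrow_ofP (f g : term A B) : arrow_of f = arrow_of g <-> f === g.
Proof. by split=> [/eqmodP/asboolP|fg]; [|apply/eqmodP/asboolP]. Qed.

Lemma arrow_ofK (x : arrow) : arrow_of (repr x) = x.
Proof. exact: reprK. Qed.

Lemma repr_arrow_of (f : term A B) : repr (arrow_of f) === f.
Proof. by apply/arrow_ofP; rewrite arrow_ofK. Qed.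

End Quotient.

Section FreeLeftStrongComonad.
Variable P : Type.

Definition arr1 (A : fob P) : arrow A A := arrow_of (One A).

Definition arrcomp (A B C : fob P) (g : arrow B C) (f : arrow A B) : arrow A C :=
  arrow_of (repr g ∘ repr f).

Lemma arrcompE (A B C : fob P) (g : term B C) (f : term A B) :
  arrcomp (arrow_of g) (arrow_of f) = arrow_of (g ∘ f).
Proof. by apply/arrow_ofP/eqterm_Comp; apply: repr_arrow_of. Qed.

Lemma arrcomp1 (A B : fob P) (f : arrow A B) : arrcomp f (arr1 A) = f.
Proof. by rewrite -[f]arrow_ofK arrcompE; apply/arrow_ofP/cat_1r. Qed.

Lemma arr1comp (A B : fob P) (f : arrow A B) : arrcomp (arr1 B) f = f.
Proof. by rewrite -[f]arrow_ofK arrcompE; apply/arrow_ofP/cat_1l. Qed.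

Lemma arrcompA (A B C D : fob P)
    (h : arrow C D) (g : arrow B C) (f : arrow A B) :
  arrcomp h (arrcomp g f) = arrcomp (arrcomp h g) f.
Proof.
rewrite -[f]arrow_ofK -[g]arrow_ofK -[h]arrow_ofK !arrcompE.
exact/arrow_ofP/cat_A.
Qed.

Definition LScat : category := Category arrcomp1 arr1comp arrcompA.

(* The occurrences of L being counted from right to left, those of A ⊗ B
   are listed starting with those of B; the outermost L of L A comes last. *)
Fixpoint Gob (A : fob P) : nat :=
  match A with
  | Gen _ => 0
  | Unit => 0
  | Tens A B => Gob B + Gob A
  | Lob A => (Gob A).+1
  end.

(* An arrow Gob A -> Gob B of the opposite category. *)
Fixpoint Gterm (A B : fob P) (f : term A B) : monofun (Gob B) (Gob A) :=
  match f with
  | One A => mono1 (Gob A)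
  | Comp _ _ _ g f => mcomp (Gterm f) (Gterm g)
  | TensM _ _ _ _ f g => mjuxt (Gterm f) (Gterm g)
  | LM _ _ f => maddtop (Gterm f)
  | Ass A B C => mcast (esym (addnA (Gob C) (Gob B) (Gob A)))
  | AssI A B C => mcast (addnA (Gob C) (Gob B) (Gob A))
  | LU A => mcast (esym (addn0 (Gob A)))
  | LUI A => mcast (addn0 (Gob A))
  | RU A => mcast (esym (add0n (Gob A)))
  | RUI A => mcast (add0n (Gob A))
  | Eps A => mface (Gob A)
  | Del A => mdegen (Gob A)
  | Psi A B => mcast (esym (addnS (Gob B) (Gob A)))
  end.

(* To compare monotone functions without case analysis on ordinals, extend
   f : m -> n to nat by m + k |-> n + k. *)
Definition ext m n (f : monofun m n) (i : nat) : nat :=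
  if insub i is Some j then f j : nat else n + (i - m).

Lemma ext_ord m n (f : monofun m n) (i : 'I_m) : ext f i = f i.
Proof. by rewrite /ext valK. Qed.

Lemma ext_out m n (f : monofun m n) i : m <= i -> ext f i = n + (i - m).
Proof. by move=> mi; rewrite /ext insubN // -leqNgt. Qed.

Lemma ext_inj m n (f g : monofun m n) : ext f =1 ext g -> f = g.
Proof. by move=> fg; apply: monofun_ext => i; rewrite -!ext_ord fg. Qed.

Lemma ext_lt m n (f : monofun m n) i : (ext f i < n) = (i < m).
Proof.
case: (ltnP i m) => [im|mi]; last by rewrite ext_out //; lia.
by rewrite -[i]/(val (Ordinal im)) ext_ord ltn_ord.
Qed.

Lemma ext_id n : ext (mono1 n) =1 id.
Proof.
move=> i; case: (ltnP i n) => [im|mi]; last by rewrite ext_out //; lia.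
by rewrite -[i]/(val (Ordinal im)) ext_ord mkmonoE.
Qed.

Lemma ext_cast m n (e : m = n) : ext (mcast e) =1 id.
Proof.
move=> i; case: (ltnP i m) => [im|mi]; last by rewrite ext_out //; lia.
by rewrite -[i]/(val (Ordinal im)) ext_ord mkmonoE.
Qed.

Lemma ext_comp m n p (g : monofun n p) (f : monofun m n) :
  ext (mcomp g f) =1 (fun i => ext g (ext f i)).
Proof.
move=> i; case: (ltnP i m) => [im|mi].
  by rewrite -[i]/(val (Ordinal im)) !ext_ord mkmonoE.
by rewrite ext_out // [ext f _]ext_out // ext_out; lia.
Qed.

Lemma ext_juxt m n m' n' (f : monofun m n) (g : monofun m' n') i :
  ext (mjuxt f g) i = if i < m' then ext g i else n' + ext f (i - m').
Proof.
case: (ltnP i (m' + m)) => im; last first.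
  by rewrite ext_out // ifN -?leqNgt ?ext_out; lia.
rewrite -[X in ext (mjuxt f g) X]/(val (Ordinal im)) ext_ord mkmonoE /juxt.
case: splitP => j /= ->; first by rewrite ltn_ord ext_ord.
by rewrite ltnNge leq_addr /= addKn ext_ord.
Qed.

Lemma ext_addtop m n (f : monofun m n) : ext (maddtop f) =1 ext f.
Proof.
move=> i; case: (ltnP i m.+1) => im; last by rewrite !ext_out; lia.
rewrite -[X in ext (maddtop f) X]/(val (Ordinal im)) ext_ord mkmonoE val_addtop /=.
by rewrite /ext; case: insubP => //=; lia.
Qed.

Lemma ext_face n i : ext (mface n) i = if i < n then i else i.+1.
Proof.
case: (ltnP i n) => [im|mi]; last by rewrite ext_out //; lia.
by rewrite -[i]/(val (Ordinal im)) ext_ord mkmonoE.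
Qed.

Lemma ext_degen n i : ext (mdegen n) i = if i <= n then i else i.-1.
Proof.
case: (ltnP i n.+2) => [im|mi]; last first.
  by rewrite ext_out // leqNgt; case: (ltnP n i) => /=; lia.
rewrite -[X in ext (mdegen n) X]/(val (Ordinal im)) ext_ord mkmonoE /=.
by rewrite inordK; case: (leqP i n) => //; lia.
Qed.

Definition extE :=
  (ext_id, ext_cast, ext_comp, ext_juxt, ext_addtop, ext_face, ext_degen).

Ltac case_ifs := repeat match goal with |- context [if ?b then _ else _] =>
  lazymatch b with context [if _ then _ else _] => fail | _ => case: (boolP b) end
  end.

Lemma Gterm_eq (A B : fob P) (f g : term A B) : f === g -> Gterm f = Gterm g.
Proof.
elim=> {A B f g} //=; try by move=> *; congruence.
all: intros; apply: ext_inj => k; rewrite !extE.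
all: try by []; try by case_ifs; lia.
- have := ext_lt (Gterm g') k; case: (ltnP k (Gob B'')) => [_ ->|_ _] //.
  by rewrite ltnNge leq_addr addKn.
- rewrite -subnDA; case: (ltnP k (Gob C')) => kC; first by rewrite ltn_addr.
  by rewrite ltn_subLR //; case: ifP => _; rewrite ?addnA.
- by case: ltnP => // ?; rewrite ext_out.
- by rewrite subn0.
- rewrite ext_lt; case: ltnP => // kB.
  by rewrite !ext_out //; lia.
- have := ext_lt (Gterm f) k; case: (ltnP k (Gob B)) => kB ltA.
    by rewrite (ltnW kB) ltnW.
  rewrite [ext _ k]ext_out //; case: (leqP k (Gob B)) => kB'.
    by rewrite ext_out //; case_ifs; lia.
  by rewrite ext_out; case_ifs; lia.
Qed.

Definition Garr (A B : fob P) (f : arrow A B) : monofun (Gob B) (Gob A) :=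
  Gterm (repr f).

Lemma GarrE (A B : fob P) (f : term A B) : Garr (arrow_of f) = Gterm f.
Proof. by apply/Gterm_eq/repr_arrow_of. Qed.

Lemma Garr1 (A : LScat) : Garr (idc A) = idc (Gob A : op Delta).
Proof. exact: GarrE. Qed.

Lemma GarrM (A B C : LScat) (g : hom B C) (f : hom A B) :
  Garr (compc g f) =
  @compc (op Delta) (Gob A) (Gob B) (Gob C) (Garr g) (Garr f).
Proof. exact: GarrE. Qed.

Definition G : functor LScat (op Delta) :=
  @Functor LScat (op Delta) Gob Garr Garr1 GarrM.

End FreeLeftStrongComonad.

(* Main.v *)
From mathcomp Require Import all_boot.
From mathcomp Require Import boolp.
From mathcomp Require Import zify.
From Stdlib Require Import Setoid Morphisms.
Require Import Defs.

(** An arrow only deletes occurrences of L (by ε), duplicates them (by δ),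
    and enlarges their scopes (by ψ); the function G f records the first two.
    Faithfulness follows by separating the two kinds of change.

    Let k give the size k i of the fibre of G f over each occurrence i of L in
    the source A.  Replacing the i-th L by its k i-th iterate yields an object
    [expand A k], and iterated comultiplications yield an arrow
    [expansion A k] from A to it.  Since ε and δ are natural and commute with
    ψ, they can be moved to the front: f = h ∘ expansion A k with h free of ε
    and δ ([expansion_nat] and [expansion_one]).  The second factor depends on
    G f only, so it remains to see that h is determined by its source and
    target.

    This is a coherence theorem for left strong endofunctors
    ([linear_coherence]).  By recursion on the target B, call an arrow A -> B
    canonical if, up to a structural isomorphism of A, it is f1 ⊗ f2 when
    B = B1 ⊗ B2, and L f1 ∘ ψ when B = L B1, with canonical f1 and f2; when B
    is I or a generator, it must be a structural isomorphism itself.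
    Canonical arrows are closed under postcomposition with ψ, the structural
    isomorphisms, their tensor products and images under L ([canonical_comp]), so that every
    arrow free of ε and δ is canonical.  They are unique by induction on B
    ([canonical_unique]): f1 has as many symbols in its source as in its
    target, hence the bracketing of A into A1 ⊗ A2 is forced up to structural
    isomorphism, and Mac Lane coherence ([structural_coherence]) provides the
    comparison. *)

Set Implicit Arguments.
Unset Strict Implicit.
Unset Printing Implicit Defensive.

Local Open Scope lsc_scope.

Local Notation "A ⊗ B" := (Tens A B)
  (at level 40, left associativity) : lsc_scope.
Local Notation "g ∘ f" := (Comp g f)
  (at level 45, right associativity) : lsc_scope.
Local Notation "f ⊗₁ g" := (TensM f g)
  (at level 40, left associativity) : lsc_scope.

(** * Equational reasoning in the free structure *)

#[local] Instance eqterm_Equivalence P (A B : fob P) :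
  Equivalence (@eqterm P A B).
Proof.
split=> [f|f g|f g h].
- exact: eqterm_refl.
- exact: eqterm_sym.
- exact: eqterm_trans.
Qed.

#[local] Hint Resolve eqterm_refl : core.

#[local] Instance Comp_Proper P (A B C : fob P) :
  Proper (@eqterm P B C ==> @eqterm P A B ==> @eqterm P A C) (@Comp P A B C).
Proof. by move=> g g' eg f f' ef; apply: eqterm_Comp. Qed.

#[local] Instance TensM_Proper P (A A' B B' : fob P) :
  Proper (@eqterm P A A' ==> @eqterm P B B' ==> @eqterm P (A ⊗ B) (A' ⊗ B'))
    (@TensM P A A' B B').
Proof. by move=> f f' ef g g' eg; apply: eqterm_TensM. Qed.

#[local] Instance LM_Proper P (A B : fob P) :
  Proper (@eqterm P A B ==> @eqterm P (Lob A) (Lob B)) (@LM P A B).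
Proof. by move=> f f' ef; apply: eqterm_LM. Qed.

Section FreeStructure.
Variable P : Type.
Implicit Types A B C N : fob P.

Lemma comp_eq A B C D (f : term A B) (g : term B C) (h : term A C)
    (x : term D A) :
  g ∘ f === h -> g ∘ f ∘ x === h ∘ x.
Proof. by move=> e; rewrite cat_A e. Qed.

Lemma comp_eq2 A B B' C D (f : term A B) (g : term B C) (f' : term A B')
    (g' : term B' C) (x : term D A) :
  g ∘ f === g' ∘ f' -> g ∘ f ∘ x === g' ∘ f' ∘ x.
Proof. by move=> e; rewrite cat_A e -cat_A. Qed.

Lemma cancel_epi A B C (x y : term B C) (u : term A B) (v : term B A) :
  u ∘ v === One B -> x ∘ u === y ∘ u -> x === y.
Proof.
by move=> uv e; rewrite -[x]cat_1r -[y]cat_1r -uv !cat_A e.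
Qed.

Lemma tens_l A B C N (g : term B C) (f : term A B) :
  (g ∘ f) ⊗₁ One N === (g ⊗₁ One N) ∘ (f ⊗₁ One N).
Proof. by rewrite -tens_M cat_1l. Qed.

Lemma tens_r A B C N (g : term B C) (f : term A B) :
  One N ⊗₁ (g ∘ f) === (One N ⊗₁ g) ∘ (One N ⊗₁ f).
Proof. by rewrite -tens_M cat_1l. Qed.

Lemma tens_lr A A' B B' (f : term A A') (g : term B B') :
  f ⊗₁ g === (f ⊗₁ One B') ∘ (One A ⊗₁ g).
Proof. by rewrite -tens_M cat_1l cat_1r. Qed.

Lemma tens_rl A A' B B' (f : term A A') (g : term B B') :
  f ⊗₁ g === (One A' ⊗₁ g) ∘ (f ⊗₁ One B).
Proof. by rewrite -tens_M cat_1l cat_1r. Qed.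

Lemma RU_faithful A B (f g : term A B) :
  f ⊗₁ One Unit === g ⊗₁ One Unit -> f === g.
Proof.
by move=> e; apply: (cancel_epi (RU_RUI A)); rewrite -!RU_nat e.
Qed.

Lemma LU_faithful A B (f g : term A B) :
  One Unit ⊗₁ f === One Unit ⊗₁ g -> f === g.
Proof.
by move=> e; apply: (cancel_epi (LU_LUI A)); rewrite -!LU_nat e.
Qed.

(** Kelly's redundancy of this unit axiom: tensoring with I on the left is
    faithful, and after composing with the isomorphism of the pentagon at
    I, I, A, B both sides reduce to r ⊗ 1 by the triangle. *)
Lemma LU_Ass A B : LU (A ⊗ B) ∘ Ass Unit A B === LU A ⊗₁ One B.
Proof.
apply: LU_faithful.
have e : (Ass Unit (Unit ⊗ A) B ∘ (Ass Unit Unit A ⊗₁ One B)) ∘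
    ((AssI Unit Unit A ⊗₁ One B) ∘ AssI Unit (Unit ⊗ A) B) === One _.
  rewrite -cat_A (comp_eq _ (h := One _)) ?cat_1l ?Ass_AssI //.
  by rewrite -tens_l Ass_AssI tens_1.
apply: (cancel_epi e).
rewrite tens_r -cat_A -pentagon cat_A triangle -[One (A ⊗ B)]tens_1 -Ass_nat.
by rewrite cat_A -Ass_nat -cat_A -tens_l triangle.
Qed.

(** * Coherence of the structural isomorphisms *)

Fixpoint structural A B (f : term A B) : bool :=
  match f with
  | Comp _ _ _ g f => structural g && structural f
  | TensM _ _ _ _ f g => structural f && structural g
  | LM _ _ f => structural f
  | Eps _ | Del _ | Psi _ _ => false
  | _ => true
  end.

(** Terms free of ε and δ use each occurrence of L in the source exactly
    once. *)
Fixpoint linear A B (f : term A B) : bool :=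
  match f with
  | Comp _ _ _ g f => linear g && linear f
  | TensM _ _ _ _ f g => linear f && linear g
  | LM _ _ f => linear f
  | Eps _ | Del _ => false
  | _ => true
  end.

Lemma structural_inv A B (f : term A B) : structural f ->
  exists2 g : term B A, structural g & f ∘ g === One B /\ g ∘ f === One A.
Proof.
elim: f => {A B} //=.
- by move=> A _; exists (One A); rewrite //= cat_1l.
- move=> A B C g IHg f IHf /andP[/IHg [g' ag [gg' g'g]] /IHf [f' af [ff' f'f]]].
  exists (f' ∘ g'); first by rewrite /= af ag.
  by rewrite -!cat_A (comp_eq _ ff') (comp_eq _ g'g) !cat_1l.
- move=> A A' B B' f IHf g IHg /andP[/IHf [f' af [ff' f'f]] /IHg [g' ag [gg' g'g]]].
  exists (f' ⊗₁ g'); first by rewrite /= af ag.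
  by rewrite -!tens_M ff' f'f gg' g'g !tens_1.
- move=> A B f IHf /IHf [f' af [ff' f'f]]; exists (LM f') => //.
  by rewrite -!L_M ff' f'f !L_1.
- move=> A B C _; exists (AssI A B C) => //.
  by split; [exact: Ass_AssI | exact: AssI_Ass].
- move=> A B C _; exists (Ass A B C) => //.
  by split; [exact: AssI_Ass | exact: Ass_AssI].
- by move=> A _; exists (LUI A) => //; split; [exact: LU_LUI | exact: LUI_LU].
- by move=> A _; exists (LU A) => //; split; [exact: LUI_LU | exact: LU_LUI].
- by move=> A _; exists (RUI A) => //; split; [exact: RU_RUI | exact: RUI_RU].
- by move=> A _; exists (RU A) => //; split; [exact: RUI_RU | exact: RU_RUI].
Qed.

(** The accumulator N makes the two bracketings of A ⊗ B ⊗ C, and A with or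
    without units, have convertible normal forms. *)
Fixpoint norm A N : fob P :=
  match A with
  | Gen _ => A ⊗ N
  | Unit => N
  | Tens B C => norm B (norm C N)
  | Lob B => Lob (norm B Unit) ⊗ N
  end.

Fixpoint norm_iso A N : term (A ⊗ N) (norm A N) :=
  match A return term (A ⊗ N) (norm A N) with
  | Gen p => One (Gen p ⊗ N)
  | Unit => LU N
  | Tens B C => norm_iso B (norm C N) ∘ (One B ⊗₁ norm_iso C N) ∘ Ass B C N
  | Lob B => LM (norm_iso B Unit ∘ RUI B) ⊗₁ One N
  end.

(** Normal forms linked by a structural term are equal without being
    convertible, hence the transport. *)
Definition cast A B (e : A = B) : term A B :=
  match e with erefl => One A end.

Lemma castE A (e : A = A) : cast e = One A.
Proof. by rewrite (Prop_irrelevance e erefl). Qed.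

Lemma structural_cast A B (e : A = B) : structural (cast e).
Proof. by case: _ / e. Qed.

Lemma structural_norm_iso A N : structural (norm_iso A N).
Proof. by elim: A N => //= [B IHB C IHC|B IHB] N; rewrite ?IHB ?IHC. Qed.

Lemma norm_iso_cast A N N' (e : N = N') (e' : norm A N = norm A N') :
  norm_iso A N' ∘ (One A ⊗₁ cast e) === cast e' ∘ norm_iso A N.
Proof. by case: N' / e e' => e'; rewrite !castE tens_1 cat_1l cat_1r. Qed.

Lemma RUI_nat A B (f : term A B) : RUI B ∘ f === (f ⊗₁ One Unit) ∘ RUI A.
Proof.
apply: (cancel_epi (RU_RUI A)).
by rewrite -cat_A -RU_nat (comp_eq _ (RUI_RU _)) cat_1l -cat_A RUI_RU cat_1r.
Qed.

Lemma LUI_nat A B (f : term A B) : LUI B ∘ f === (One Unit ⊗₁ f) ∘ LUI A.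
Proof.
apply: (cancel_epi (LU_LUI A)).
by rewrite -cat_A -LU_nat (comp_eq _ (LUI_LU _)) cat_1l -cat_A LUI_LU cat_1r.
Qed.

Lemma AssI_nat A A' B B' C C' (f : term A A') (g : term B B') (h : term C C') :
  AssI A' B' C' ∘ (f ⊗₁ (g ⊗₁ h)) === ((f ⊗₁ g) ⊗₁ h) ∘ AssI A B C.
Proof.
apply: (cancel_epi (Ass_AssI A B C)).
rewrite -cat_A -Ass_nat (comp_eq _ (AssI_Ass _ _ _)) cat_1l -cat_A.
by rewrite AssI_Ass cat_1r.
Qed.

(** Every structural term becomes an identity between normal forms.  The
    pentagon, Kelly's equation and the triangle give the cases of a, l and r;
    [inv] transfers each of them to the inverse. *)
Lemma norm_iso_structural A B (f : term A B) N : structural f ->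
  exists e : norm A N = norm B N,
    norm_iso B N ∘ (f ⊗₁ One N) === cast e ∘ norm_iso A N.
Proof.
have inv A' B' (g : term A' B') (g' : term B' A') M (e : norm A' M = norm B' M) :
    g ∘ g' === One B' ->
    norm_iso B' M ∘ (g ⊗₁ One M) === cast e ∘ norm_iso A' M ->
  exists e : norm B' M = norm A' M,
    norm_iso A' M ∘ (g' ⊗₁ One M) === cast e ∘ norm_iso B' M.
  move=> gg' eg; exists (esym e).
  have ce : cast (esym e) ∘ cast e === One _ by case: _ / e {eg}; exact: cat_1l.
  rewrite -[norm_iso A' M]cat_1l -ce -[_ ∘ norm_iso A' M]cat_A -eg -!cat_A.
  by rewrite -tens_l gg' tens_1 cat_1r.
have eAss A' B' C' M : norm_iso (A' ⊗ (B' ⊗ C')) M ∘ (Ass A' B' C' ⊗₁ One M) ===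
    norm_iso ((A' ⊗ B') ⊗ C') M.
  rewrite /= -!cat_A !tens_r -!cat_A -pentagon -[One (A' ⊗ B')]tens_1.
  by rewrite [Ass A' B' _ ∘ _ ∘ _]cat_A Ass_nat -!cat_A.
have eLU A' M : norm_iso A' M ∘ (LU A' ⊗₁ One M) === norm_iso (Unit ⊗ A') M.
  by rewrite /= cat_A LU_nat -cat_A LU_Ass.
have eRU A' M : norm_iso A' M ∘ (RU A' ⊗₁ One M) === norm_iso (A' ⊗ Unit) M.
  by rewrite /= triangle.
elim: f N => {A B} //=.
- by move=> A N _; exists erefl; rewrite tens_1 cat_1l cat_1r.
- move=> A B C g IHg f IHf N /andP[/(IHg N) [eg Eg] /(IHf N) [ef Ef]].
  exists (etrans ef eg); rewrite tens_l cat_A Eg -cat_A Ef cat_A.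
  by case: _ / eg {Eg}; rewrite cat_1l.
- move=> A A' B B' f IHf g IHg N /andP[/IHf {}IHf /(IHg N) [eg Eg]].
  have [ef Ef] := IHf (norm B' N); have e1 := congr1 (norm A) eg.
  exists (etrans e1 ef); rewrite -!cat_A Ass_nat.
  rewrite [_ ⊗₁ _ ∘ _]cat_A -tens_M cat_1l Eg tens_lr tens_r.
  rewrite -!cat_A (comp_eq2 _ Ef) (comp_eq2 _ (norm_iso_cast _ e1)) !cat_A.
  by case: _ / ef {Ef}; rewrite cat_1l.
- move=> A B f IHf N /(IHf Unit) [e E].
  exists (congr1 (fun C => Lob C ⊗ N) e).
  rewrite -tens_M cat_1l -L_M -cat_A RUI_nat cat_A E -cat_A.
  by case: _ / e {E}; rewrite !cat_1l.
- by move=> A B C N _; exists erefl; rewrite eAss cat_1l.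
- move=> A B C N _; apply: (inv _ _ (Ass A B C) _ N erefl (Ass_AssI A B C)).
  by rewrite eAss cat_1l.
- by move=> A N _; exists erefl; rewrite eLU cat_1l.
- by move=> A N _; apply: (inv _ _ (LU A) _ N erefl (LU_LUI A)); rewrite eLU cat_1l.
- by move=> A N _; exists erefl; rewrite eRU cat_1l.
- by move=> A N _; apply: (inv _ _ (RU A) _ N erefl (RU_RUI A)); rewrite eRU cat_1l.
Qed.

(** Mac Lane coherence: [norm_iso] being invertible, f ⊗ 1 is determined by
    the equality of normal forms, of which there is only one proof. *)
Lemma structural_coherence A B (f g : term A B) :
  structural f -> structural g -> f === g.
Proof.
move=> /(norm_iso_structural Unit) [ef Ef] /(norm_iso_structural Unit) [eg Eg].
have [n _ [_ nn]] := structural_inv (structural_norm_iso B Unit).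
apply: RU_faithful; rewrite -[f ⊗₁ _]cat_1l -[g ⊗₁ _]cat_1l -nn -!cat_A Ef Eg.
by rewrite (Prop_irrelevance ef eg).
Qed.

Lemma structural_norm A B :
  norm A Unit = norm B Unit -> exists f : term A B, structural f.
Proof.
move=> e; have [n an _] := structural_inv (structural_norm_iso B Unit).
exists (RU B ∘ n ∘ cast e ∘ norm_iso A Unit ∘ RUI A).
by rewrite /= an structural_cast structural_norm_iso.
Qed.

(** The number of generators and of occurrences of L. *)
Fixpoint weight A : nat :=
  match A with
  | Gen _ => 1
  | Unit => 0
  | Tens A B => weight A + weight B
  | Lob A => (weight A).+1
  end.

Lemma weight_linear A B (f : term A B) : linear f -> weight A = weight B.
Proof.
elim: f => {A B} //= *; lia.
Qed.

Lemma structural_linear A B (f : term A B) : structural f -> linear f.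
Proof.
elim: f => {A B} //=.
- by move=> A B C g IHg f IHf /andP[/IHg -> /IHf].
- by move=> A A' B B' f IHf g IHg /andP[/IHf -> /IHg ->].
Qed.

(** The list of tensor factors of the normal form; it makes cancellation in
    tensor products available. *)
Fixpoint factors A : seq (fob P) :=
  match A with
  | Gen _ => [:: A]
  | Unit => [::]
  | Tens A B => factors A ++ factors B
  | Lob B => [:: Lob (norm B Unit)]
  end.

Lemma norm_factors A N : norm A N = foldr (@Tens P) N (factors A).
Proof. by elim: A N => //= A IHA B IHB N; rewrite foldr_cat IHA IHB. Qed.

Lemma weight_norm A N : weight (norm A N) = weight A + weight N.
Proof. by elim: A N => //= [B IHB C IHC|B IHB] N; rewrite ?IHB ?IHC /=; lia. Qed.

Lemma weight_factors A : weight A = sumn (map weight (factors A)).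
Proof.
by elim: A => //= [A -> B ->|A _]; rewrite ?map_cat ?sumn_cat // weight_norm /= !addn0.
Qed.

Lemma factors_gt0 A : all (fun B => 0 < weight B) (factors A).
Proof. by elim: A => //= A IHA B IHB; rewrite all_cat IHA IHB. Qed.

(** Factors of positive weight cannot move across the boundary between s and
    the tail without changing the total weight of s. *)
Lemma foldr_Tens_inj (s s' : seq (fob P)) N N' :
    all (fun B => 0 < weight B) s -> all (fun B => 0 < weight B) s' ->
    sumn (map weight s) = sumn (map weight s') ->
  foldr (@Tens P) N s = foldr (@Tens P) N' s' -> s = s' /\ N = N'.
Proof.
elim: s s' => [|A s IHs] [|A' s'] //=; try lia.
move=> /andP[_ ss] /andP[_ ss'] ew [eA e]; rewrite eA in ew *.
by have [-> ->] := IHs s' ss ss' (addnI ew) e.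
Qed.

(** Both bracketings have the factors of A, and equality of the weights makes
    them cut this list at the same place. *)
Lemma structural_split A A1 A2 A1' A2'
    (f : term A (A1 ⊗ A2)) (f' : term A (A1' ⊗ A2')) :
    weight A1 = weight A1' -> structural f -> structural f' ->
  exists (b1 : term A1 A1') (b2 : term A2 A2'),
    [/\ structural b1, structural b2 & f' === (b1 ⊗₁ b2) ∘ f].
Proof.
move=> ew af af'.
have [e _] := norm_iso_structural Unit af; have [e' _] := norm_iso_structural Unit af'.
have /= := etrans (esym e) e'; rewrite ![norm _ (norm _ _)]norm_factors => {}e.
move: ew; rewrite !weight_factors => ew.
have [e1 e2] := foldr_Tens_inj (factors_gt0 _) (factors_gt0 _) ew e.
have [|b1 ab1] := @structural_norm A1 A1'; first by rewrite !norm_factors e1.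
have [b2 ab2] := structural_norm e2.
by exists b1, b2; split=> //; apply: structural_coherence; rewrite //= ab1 ab2.
Qed.

(** Here both cuts come right after the first factor. *)
Lemma structural_split_L A A1 A2 A1' A2'
    (f : term A (Lob A1 ⊗ A2)) (f' : term A (Lob A1' ⊗ A2')) :
    structural f -> structural f' ->
  exists (b1 : term A1 A1') (b2 : term A2 A2'),
    [/\ structural b1, structural b2 & f' === (LM b1 ⊗₁ b2) ∘ f].
Proof.
move=> af af'.
have [e _] := norm_iso_structural Unit af; have [e' _] := norm_iso_structural Unit af'.
have /= [/structural_norm [b1 ab1] /structural_norm [b2 ab2]] := etrans (esym e) e'.
by exists b1, b2; split=> //; apply: structural_coherence; rewrite //= ab1 ab2.
Qed.

(** * Coherence of left strong endofunctors *)

Fixpoint canonical B : forall A, term A B -> Prop :=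
  match B return forall A, term A B -> Prop with
  | Gen p => fun A f => exists2 h : term A (Gen p), structural h & f === h
  | Unit => fun A f => exists2 h : term A Unit, structural h & f === h
  | Tens B1 B2 => fun A f =>
      exists A1 A2 (h : term A (A1 ⊗ A2)) (f1 : term A1 B1) (f2 : term A2 B2),
        [/\ structural h, canonical f1, canonical f2 & f === (f1 ⊗₁ f2) ∘ h]
  | Lob B1 => fun A f =>
      exists A1 A2 (h : term A (Lob A1 ⊗ A2)) (f1 : term (A1 ⊗ A2) B1),
        [/\ structural h, canonical f1 & f === LM f1 ∘ Psi A1 A2 ∘ h]
  end.

Lemma canonical_eq A B (f g : term A B) : f === g -> canonical f -> canonical g.
Proof.
case: B f g => [p||B1 B2|B1] f g fg /=.
- by case=> h ah e; exists h => //; rewrite -fg.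
- by case=> h ah e; exists h => //; rewrite -fg.
- move=> [A1 [A2 [h [f1 [f2 [ah g1 g2 e]]]]]]; exists A1, A2, h, f1, f2.
  by split=> //; rewrite -fg.
- move=> [A1 [A2 [h [f1 [ah g1 e]]]]]; exists A1, A2, h, f1.
  by split=> //; rewrite -fg.
Qed.

Lemma canonical_structural A A' B (f : term A B) (h : term A' A) :
  structural h -> canonical f -> canonical (f ∘ h).
Proof.
move=> ah; case: B f => [p||B1 B2|B1] f /=.
- by case=> k ak e; exists (k ∘ h); rewrite ?e //= ak.
- by case=> k ak e; exists (k ∘ h); rewrite ?e //= ak.
- move=> [A1 [A2 [k [f1 [f2 [ak g1 g2 e]]]]]]; exists A1, A2, (k ∘ h), f1, f2.
  by split=> //=; rewrite ?ak // e cat_A.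
- move=> [A1 [A2 [k [f1 [ak g1 e]]]]]; exists A1, A2, (k ∘ h), f1.
  by split=> //=; rewrite ?ak // e !cat_A.
Qed.

Lemma canonical_tens A A' B B' (f : term A A') (g : term B B') :
  canonical f -> canonical g -> canonical (f ⊗₁ g).
Proof.
by move=> gf gg; exists A, B, (One _), f, g; split=> //; rewrite cat_1r.
Qed.

(** The unit law of ψ writes the identity of L A as L r ∘ ψ ∘ r^-1. *)
Lemma canonical_one A : canonical (One A).
Proof.
elim: A => [p||A IHA B IHB|A IHA].
- by exists (One _).
- by exists (One _).
- exact: (canonical_eq (tens_1 A B) (canonical_tens IHA IHB)).
- exists A, Unit, (RUI _), (RU A); split=> //.
    by apply: (canonical_eq (cat_1l _)); apply: canonical_structural.
  by rewrite cat_A Psi_RU RU_RUI.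
Qed.

(** By induction on the postcomposed term.  For an associativity the
    decomposition of f is rebracketed; for ψ after L f1 ∘ ψ, naturality and the
    compatibility of ψ with a merge the two strengths into one. *)
Lemma canonical_comp A B C (g : term B C) (f : term A B) :
  linear g -> canonical f -> canonical (g ∘ f).
Proof.
elim: g A f => {B C}.
- by move=> B A f _; apply: canonical_eq; rewrite cat_1l.
- move=> B C D h IHh g IHg A f /= /andP[sh sg] gf.
  by apply: (canonical_eq (cat_A h g f)); apply: IHh => //; apply: IHg.
- move=> B B' C C' g IHg g' IHg' A f /= /andP[sg sg'].
  move=> [A1 [A2 [h [f1 [f2 [ah gf1 gf2 e]]]]]].
  exists A1, A2, h, (g ∘ f1), (g' ∘ f2); split; [done|exact: IHg|exact: IHg'|].
  by rewrite e tens_M cat_A.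
- move=> B C g IHg A f /= sg [A1 [A2 [h [f1 [ah gf1 e]]]]].
  exists A1, A2, h, (g ∘ f1); split; [done|exact: IHg|].
  by rewrite e L_M cat_A.
- move=> B1 B2 B3 A f _ [A' [A3 [h [f' [f3 [ah gf' gf3 e]]]]]].
  have [A1 [A2 [h' [f1 [f2 [ah' gf1 gf2 e']]]]]] := gf'.
  exists A1, (A2 ⊗ A3), (Ass A1 A2 A3 ∘ (h' ⊗₁ One A3) ∘ h), f1, (f2 ⊗₁ f3).
  split; [by rewrite /= ah' ah | done | exact: canonical_tens |].
  by rewrite e e' -[f3 in X in X === _]cat_1r tens_M !cat_A Ass_nat.
- move=> B1 B2 B3 A f _ [A1 [A' [h [f1 [f' [ah gf1 gf' e]]]]]].
  have [A2 [A3 [h' [f2 [f3 [ah' gf2 gf3 e']]]]]] := gf'.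
  exists (A1 ⊗ A2), A3, (AssI A1 A2 A3 ∘ (One A1 ⊗₁ h') ∘ h), (f1 ⊗₁ f2), f3.
  split; [by rewrite /= ah' ah | exact: canonical_tens | done |].
  by rewrite e e' -[f1 in X in X === _]cat_1r tens_M !cat_A AssI_nat.
- move=> B A f _ [A1 [A2 [h [f1 [f2 [ah [h1 ah1 e1] gf2 e]]]]]].
  apply: (canonical_eq _ (canonical_structural (h := LU A2 ∘ (h1 ⊗₁ One A2) ∘ h) _ gf2)).
    by rewrite e e1 [_ ⊗₁ f2]tens_rl !cat_A LU_nat.
  by rewrite /= ah1 ah.
- move=> B A f _ gf; exists Unit, A, (LUI A), (One _), f.
  by split=> //; [exists (One _) | rewrite LUI_nat].
- move=> B A f _ [A1 [A2 [h [f1 [f2 [ah gf1 [h2 ah2 e2] e]]]]]].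
  apply: (canonical_eq _ (canonical_structural (h := RU A1 ∘ (One A1 ⊗₁ h2) ∘ h) _ gf1)).
    by rewrite e e2 [f1 ⊗₁ _]tens_lr !cat_A RU_nat.
  by rewrite /= ah2 ah.
- move=> B A f _ gf; exists A, Unit, (RUI A), f, (One _).
  by split=> //; [exists (One _) | rewrite RUI_nat].
- by [].
- by [].
- move=> B1 B2 A f _ [A' [A3 [h [f' [f3 [ah gf' gf3 e]]]]]].
  have [A1 [A2 [h' [f1 [ah' gf1 e']]]]] := gf'.
  exists A1, (A2 ⊗ A3), (Ass _ _ _ ∘ (h' ⊗₁ One A3) ∘ h), ((f1 ⊗₁ f3) ∘ AssI A1 A2 A3).
  split; [by rewrite /= ah' ah | |].
    by apply: canonical_structural => //; apply: canonical_tens.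
  rewrite e e' -[f3 in X in X === _]cat_1r !tens_M -!cat_A.
  rewrite (comp_eq2 _ (Psi_nat f1 f3)) L_M -!cat_A.
  have ePsi : LM (AssI A1 A2 A3) ∘ Psi A1 (A2 ⊗ A3) ∘ Ass (Lob A1) A2 A3 ===
      Psi (A1 ⊗ A2) A3 ∘ (Psi A1 A2 ⊗₁ One A3).
    by rewrite -Psi_Ass cat_A -L_M AssI_Ass L_1 cat_1l.
  by rewrite [Psi _ _ ∘ Ass _ _ _ ∘ _]cat_A (comp_eq _ ePsi) tens_l -!cat_A.
Qed.

Lemma canonical_weight A B (f : term A B) : canonical f -> weight A = weight B.
Proof.
elim: B A f => [p||B1 IH1 B2 IH2|B1 IH1] A f /=.
- by case=> h /structural_linear/weight_linear.
- by case=> h /structural_linear/weight_linear.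
- move=> [A1 [A2 [h [f1 [f2 [/structural_linear/weight_linear ah g1 g2 e]]]]]].
  by rewrite ah /= (IH1 _ _ g1) (IH2 _ _ g2).
- move=> [A1 [A2 [h [f1 [/structural_linear/weight_linear ah g1 e]]]]].
  by rewrite ah -(IH1 _ _ g1).
Qed.

(** The weights of A1 and A1' both equal that of the corresponding part of the
    target, so the two decompositions differ by structural b1 and b2, which the
    induction hypothesis absorbs. *)
Lemma canonical_unique A B (f g : term A B) :
  canonical f -> canonical g -> f === g.
Proof.
elim: B A f g => [p||B1 IH1 B2 IH2|B1 IH1] A f g /=.
- by move=> [h ah ->] [k ak ->]; apply: structural_coherence.
- by move=> [h ah ->] [k ak ->]; apply: structural_coherence.
- move=> [A1 [A2 [h [f1 [f2 [ah gf1 gf2 ->]]]]]].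
  move=> [A1' [A2' [k [g1 [g2 [ak gg1 gg2 ->]]]]]].
  have [|b1 [b2 [ab1 ab2 ->]]] := structural_split _ ah ak.
    by rewrite (canonical_weight gf1) (canonical_weight gg1).
  rewrite (IH1 _ f1 (g1 ∘ b1)) //; last exact: canonical_structural.
  rewrite (IH2 _ f2 (g2 ∘ b2)) //; last exact: canonical_structural.
  by rewrite tens_M cat_A.
- move=> [A1 [A2 [h [f1 [ah gf1 ->]]]]] [A1' [A2' [k [g1 [ak gg1 ->]]]]].
  have [b1 [b2 [ab1 ab2 ->]]] := structural_split_L ah ak.
  rewrite (IH1 _ f1 (g1 ∘ (b1 ⊗₁ b2))) //.
    by rewrite L_M -!cat_A (comp_eq2 _ (Psi_nat b1 b2)).
  by apply: canonical_structural; rewrite //= ab1.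
Qed.

Lemma linear_coherence A B (f g : term A B) : linear f -> linear g -> f === g.
Proof.
move=> sf sg; rewrite -[f]cat_1r -[g]cat_1r.
by apply: canonical_unique; apply: canonical_comp => //; apply: canonical_one.
Qed.

(** * Multiplicities along monotone functions *)

(** For k constantly 1, the cardinal of the fibre. *)
Definition fibre_sum m n (f : monofun m n) (k : nat -> nat) (i : nat) : nat :=
  \sum_(j < m | f j == i :> nat) k j.

Lemma fibre_sum_id n (f : monofun n n) k i :
  (forall j, f j = j :> nat) -> i < n -> fibre_sum f k i = k i.
Proof.
move=> fE lt_in; rewrite /fibre_sum (big_pred1 (Ordinal lt_in)) // => j.
by rewrite fE.
Qed.

Lemma fibre_sum_cast m n (e : m = n) k i : i < n -> fibre_sum (mcast e) k i = k i.
Proof.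
case: n / e => lt_im; apply: fibre_sum_id => // j; by rewrite mkmonoE.
Qed.

Lemma fibre_sum_one n k i : i < n -> fibre_sum (mono1 n) k i = k i.
Proof. by apply: fibre_sum_id => j; rewrite mkmonoE. Qed.

Lemma fibre_sum_comp m n p (g : monofun n p) (f : monofun m n) k i :
  fibre_sum (mcomp g f) k i = fibre_sum g (fibre_sum f k) i.
Proof.
rewrite /fibre_sum (partition_big (fun j => f j) (fun b => g b == i :> nat)) /=;
  last by move=> j; rewrite ffunE.
apply: eq_bigr => b gb; apply: eq_bigl => j; rewrite ffunE.
case: (eqVneq (f j) b) => [->|ne]; first by rewrite gb eqxx.
by rewrite andbF val_eqE (negbTE ne).
Qed.

Lemma juxt_small m n m' n' (f : 'I_m -> 'I_n) (g : 'I_m' -> 'I_n') j :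
  juxt f g (lshift m j) = lshift n (g j).
Proof. by rewrite /juxt -[lshift m j]/(unsplit (inl j)) unsplitK. Qed.

Lemma juxt_large m n m' n' (f : 'I_m -> 'I_n) (g : 'I_m' -> 'I_n') j :
  juxt f g (rshift m' j) = rshift n' (f j).
Proof. by rewrite /juxt -[rshift m' j]/(unsplit (inr j)) unsplitK. Qed.

Lemma fibre_sum_juxt_small m n m' n' (f : monofun m n) (g : monofun m' n') k i :
  i < n' -> fibre_sum (mjuxt f g) k i = fibre_sum g k i.
Proof.
move=> lt_in; rewrite /fibre_sum big_split_ord /= [X in _ + X]big1 ?addn0.
  by apply: eq_bigl => j; rewrite ffunE juxt_small.
by move=> j; rewrite ffunE juxt_large /=; lia.
Qed.

Lemma fibre_sum_juxt_large m n m' n' (f : monofun m n) (g : monofun m' n') k i :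
  fibre_sum (mjuxt f g) k (n' + i) = fibre_sum f (fun j => k (m' + j)) i.
Proof.
rewrite /fibre_sum big_split_ord /= [X in X + _]big1 ?add0n.
  by apply: eq_bigl => j; rewrite ffunE juxt_large /= eqn_add2l.
by move=> j; rewrite ffunE juxt_small /=; have := ltn_ord (g j); lia.
Qed.

Lemma addtop_small m n (f : 'I_m -> 'I_n) (j : 'I_m) :
  addtop f (widen_ord (leqnSn m) j) = f j :> nat.
Proof. by rewrite val_addtop /= valK. Qed.

Lemma fibre_sum_addtop_small m n (f : monofun m n) k i :
  i < n -> fibre_sum (maddtop f) k i = fibre_sum f k i.
Proof.
move=> lt_in; rewrite /fibre_sum big_mkcond big_ord_recr /= -big_mkcond /=.
rewrite ffunE val_addtop insubN /= ?ltnn // gtn_eqF // addn0.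
by apply: eq_bigl => j; rewrite ffunE addtop_small.
Qed.

Lemma fibre_sum_addtop_top m n (f : monofun m n) k : fibre_sum (maddtop f) k n = k m.
Proof.
rewrite /fibre_sum big_mkcond big_ord_recr /= -big_mkcond /=.
rewrite ffunE val_addtop insubN /= ?ltnn // eqxx big1 // => j.
by rewrite ffunE addtop_small; have := ltn_ord (f j); lia.
Qed.

Lemma fibre_sum_face_small n k i : i < n -> fibre_sum (mface n) k i = k i.
Proof.
by move=> lt_in; rewrite /fibre_sum (big_pred1 (Ordinal lt_in)) // => j; rewrite ffunE.
Qed.

Lemma fibre_sum_face_top n k : fibre_sum (mface n) k n = 0.
Proof. by rewrite /fibre_sum big_pred0 // => j; rewrite ffunE /= ltn_eqF. Qed.

Lemma mdegenE n (j : 'I_n.+2) : mdegen n j = (if j <= n then j : nat else n) :> nat.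
Proof. by rewrite mkmonoE inordK //; case: ifP; lia. Qed.

Lemma fibre_sum_degen_small n k i : i < n -> fibre_sum (mdegen n) k i = k i.
Proof.
move=> lt_in; have lt_in2 : i < n.+2 by lia.
rewrite /fibre_sum (big_pred1 (Ordinal lt_in2)) // => j.
rewrite mdegenE /= -val_eqE /=; case: leqP => //; lia.
Qed.

Lemma fibre_sum_degen_top n k : fibre_sum (mdegen n) k n = k n + k n.+1.
Proof.
rewrite /fibre_sum big_mkcond !big_ord_recr /= -big_mkcond /= !mdegenE /= leqnn ltnn eqxx.
by rewrite big1 // => j; rewrite mdegenE /= (ltnW (ltn_ord j)) ltn_eqF.
Qed.

(** * Extracting counits and comultiplications *)

Definition Lpow n A : fob P := iter n (@Lob P) A.

Fixpoint LpowM n A B (f : term A B) : term (Lpow n A) (Lpow n B) :=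
  if n is n'.+1 return term (Lpow n A) (Lpow n B) then LM (LpowM n' f) else f.

(** The n-fold comultiplication, with ε for n = 0; for n = 1 it is Lε ∘ δ,
    hence an identity. *)
Fixpoint dup n A : term (Lob A) (Lpow n A) :=
  if n is n'.+1 return term (Lob A) (Lpow n A) then LM (dup n' A) ∘ Del A
  else Eps A.

Lemma linear_LpowM n A B (f : term A B) : linear f -> linear (LpowM n f).
Proof. by elim: n. Qed.

Lemma dup_nat n A B (f : term A B) : dup n B ∘ LM f === LpowM n f ∘ dup n A.
Proof.
elim: n => [|n IHn] /=; first exact: Eps_nat.
by rewrite -cat_A Del_nat cat_A -L_M IHn L_M cat_A.
Qed.

Lemma dup1 A : dup 1 A === One (Lob A).
Proof. exact: LEps_Del. Qed.

(** Coassociativity; h only re-associates iterates of L, equal but not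
    convertible. *)
Lemma dup_add m n A :
  exists2 h : term (Lpow (m + n) A) (Lpow m (Lpow n A)), linear h
    & dup m (Lpow n A) ∘ LM (dup n A) ∘ Del A === h ∘ dup (m + n) A.
Proof.
elim: m => [|m [h sh IHm]].
  by exists (One _); rewrite //= cat_A Eps_nat -cat_A Eps_Del cat_1r cat_1l.
exists (LM h) => //=.
rewrite -cat_A (comp_eq2 _ (Del_nat _)) Del_Del cat_A -L_M.
by rewrite cat_A -L_M -cat_A IHm L_M -cat_A.
Qed.

(** ε and δ commute with ψ, so iterated comultiplication does so with the
    iterate of ψ. *)
Lemma dup_Psi n A B :
  exists2 h : term (Lpow n A ⊗ B) (Lpow n (A ⊗ B)), linear h
    & dup n (A ⊗ B) ∘ Psi A B === h ∘ (dup n A ⊗₁ One B).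
Proof.
elim: n => [|n [h sh IHn]].
  by exists (One _); rewrite //= cat_1l Psi_Eps.
exists (LM h ∘ Psi _ _) => //=; first by rewrite sh.
rewrite -cat_A Psi_Del cat_A -L_M IHn L_M -!cat_A.
by rewrite (comp_eq2 _ (eqterm_sym (Psi_nat _ _))) tens_l.
Qed.

Fixpoint expand A (k : nat -> nat) : fob P :=
  match A with
  | Gen _ | Unit => A
  | Tens A B => expand A (fun i => k (Gob B + i)) ⊗ expand B k
  | Lob A => Lpow (k (Gob A)) (expand A k)
  end.

Fixpoint expansion A k : term A (expand A k) :=
  match A return term A (expand A k) with
  | Gen p => One (Gen p)
  | Unit => One Unit
  | Tens A B => expansion A (fun i => k (Gob B + i)) ⊗₁ expansion B k
  | Lob A => dup (k (Gob A)) (expand A k) ∘ LM (expansion A k)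
  end.

(** [expand A k] depends only on the values of k below [Gob A], but functions
    that agree there need not be equal: h replaces a transport. *)
Lemma expansion_ext A k k' : (forall i, i < Gob A -> k' i = k i) ->
  exists2 h : term (expand A k') (expand A k), linear h
    & expansion A k === h ∘ expansion A k'.
Proof.
elim: A k k' => [p||A IHA B IHB|A IHA] k k' kk' /=.
- by exists (One _); rewrite ?cat_1l.
- by exists (One _); rewrite ?cat_1l.
- have [|h sh eh] := IHA (fun i => k (Gob B + i)) (fun i => k' (Gob B + i)).
    by move=> i iA; apply: kk'; rewrite /= ltn_add2l.
  have [|g sg eg] := IHB k k'.
    by move=> i iB; apply: kk'; rewrite /= ltn_addr.
  by exists (h ⊗₁ g); rewrite /= ?sh // -tens_M -eh -eg.
- rewrite kk' //=; have [|h sh eh] := IHA k k'; first by move=> i /ltnW; apply: kk'.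
  exists (LpowM (k (Gob A)) h); first exact: linear_LpowM.
  by rewrite eh L_M cat_A dup_nat -cat_A.
Qed.

Lemma expansion_one A : exists2 h : term (expand A (fun=> 1)) A, linear h
  & h ∘ expansion A (fun=> 1) === One A.
Proof.
elim: A => [p||A [h sh eh] B [g sg eg]|A [h sh eh]] /=.
- by exists (One _); rewrite ?cat_1l.
- by exists (One _); rewrite ?cat_1l.
- by exists (h ⊗₁ g); rewrite /= ?sh // -tens_M eh eg tens_1.
- exists (LM h) => //; have := dup1 (expand A (fun=> 1)) => /= ->.
  by rewrite cat_1l -L_M eh L_1.
Qed.

(** Multiplicities k chosen on the target are pulled back through f by summing
    over the fibres of G f: an ε contributes an empty fibre, and a δ adds two
    multiplicities. *)
Lemma expansion_nat A B (f : term A B) k k' :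
  (forall i, i < Gob A -> k' i = fibre_sum (Gterm f) k i) ->
  exists2 h : term (expand A k') (expand B k), linear h
    & expansion B k ∘ f === h ∘ expansion A k'.
Proof.
have reduce A' B' (g : term A' B') l l' l'' :
    (exists2 h : term (expand A' l'') (expand B' l), linear h
      & expansion B' l ∘ g === h ∘ expansion A' l'') ->
    (forall i, i < Gob A' -> l' i = l'' i) ->
  exists2 h : term (expand A' l') (expand B' l), linear h
    & expansion B' l ∘ g === h ∘ expansion A' l'.
  move=> [h sh eh] /expansion_ext [h' sh' eh']; exists (h ∘ h'); first by rewrite /= sh.
  by rewrite eh eh' cat_A.
elim: f k k' => {A B}.
- move=> A k k' kk'; apply: (reduce _ _ _ _ _ k).
    by exists (One _); rewrite // cat_1l cat_1r.
  by move=> i iA; rewrite kk' //= fibre_sum_one.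
- move=> A B C g IHg f IHf k k' kk'.
  have [//|hg sg eg] := IHg k (fibre_sum (Gterm g) k).
  have [|hf sf ef] := IHf (fibre_sum (Gterm g) k) k'.
    by move=> i iA; rewrite kk' //= fibre_sum_comp.
  by exists (hg ∘ hf); rewrite /= ?sg // cat_A eg -cat_A ef cat_A.
- move=> A A' B B' f IHf g IHg k k' kk'.
  have [|hf sf ef] := IHf (fun i => k (Gob B' + i)) (fun i => k' (Gob B + i)).
    by move=> i iA; rewrite kk' /= ?fibre_sum_juxt_large // ltn_add2l.
  have [|hg sg eg] := IHg k k'.
    by move=> i iB; rewrite kk' /= ?fibre_sum_juxt_small // ltn_addr.
  by exists (hf ⊗₁ hg); rewrite /= ?sf // -!tens_M ef eg.
- move=> A B f IHf k k' kk'.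
  have [|h sh eh] := IHf k k'.
    by move=> i iA; rewrite kk' /= ?fibre_sum_addtop_small // ltnW.
  rewrite /= kk' //= fibre_sum_addtop_top.
  exists (LpowM (k (Gob B)) h); first exact: linear_LpowM.
  by rewrite -cat_A -L_M eh L_M cat_A dup_nat -cat_A.
- move=> A B C k k' kk'; apply: (reduce _ _ _ _ _ k).
    rewrite /=; have -> : (fun i => k (Gob C + Gob B + i)) =
      (fun i => k (Gob C + (Gob B + i))) by apply/funext => i; rewrite addnA.
    by exists (Ass _ _ _); rewrite // Ass_nat.
  by move=> i iA; rewrite kk' //= fibre_sum_cast.
- move=> A B C k k' kk'; apply: (reduce _ _ _ _ _ k).
    rewrite /=; have -> : (fun i => k (Gob C + Gob B + i)) =
      (fun i => k (Gob C + (Gob B + i))) by apply/funext => i; rewrite addnA.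
    by exists (AssI _ _ _); rewrite // AssI_nat.
  by move=> i iA; rewrite kk' //= fibre_sum_cast.
- move=> A k k' kk'; apply: (reduce _ _ _ _ _ k).
    by exists (LU _); rewrite //= LU_nat.
  by move=> i iA; rewrite kk' //= fibre_sum_cast.
- move=> A k k' kk'; apply: (reduce _ _ _ _ _ k).
    by exists (LUI _); rewrite //= LUI_nat.
  by move=> i iA; rewrite kk' //= fibre_sum_cast.
- move=> A k k' kk'; apply: (reduce _ _ _ _ _ k).
    by exists (RU _); rewrite //= RU_nat.
  by move=> i iA; rewrite kk' //= fibre_sum_cast.
- move=> A k k' kk'; apply: (reduce _ _ _ _ _ k).
    by exists (RUI _); rewrite //= RUI_nat.
  by move=> i iA; rewrite kk' //= fibre_sum_cast.
- move=> A k k' kk'; rewrite /= kk' //= fibre_sum_face_top.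
  have [|h sh eh] := @expansion_ext A k k'.
    by move=> i iA; rewrite kk' /= ?fibre_sum_face_small // ltnW.
  by exists h; rewrite // eh -cat_A -Eps_nat.
- move=> A k k' kk'; rewrite /= kk' //= fibre_sum_degen_top addnC.
  have [|h sh eh] := @expansion_ext A k k'.
    by move=> i iA; rewrite kk' /= ?fibre_sum_degen_small // ltnW.
  have [g sg eg] := dup_add (k (Gob A).+1) (k (Gob A)) (expand A k).
  exists (g ∘ LpowM (k (Gob A).+1 + k (Gob A)) h).
    by rewrite /= sg linear_LpowM.
  rewrite L_M -!cat_A -Del_nat [LM (dup _ _) ∘ _]cat_A (comp_eq _ eg).
  by rewrite eh L_M -!cat_A (comp_eq2 _ (dup_nat _ _)).
- move=> A B k k' kk'; apply: (reduce _ _ _ _ _ k).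
    rewrite /=; have [h sh eh] := dup_Psi (k (Gob B + Gob A))
      (expand A (fun i => k (Gob B + i))) (expand B k).
    exists h => //; rewrite -cat_A -Psi_nat (comp_eq _ eh) -cat_A.
    by rewrite -tens_M cat_1l.
  by move=> i iA; rewrite kk' //= fibre_sum_cast.
Qed.

Lemma Gterm_faithful A B (f g : term A B) : Gterm f = Gterm g -> f === g.
Proof.
move=> efg; have [r _ er] := expansion_one B.
have [//|h sh eh] := @expansion_nat _ _ f (fun=> 1) (fibre_sum (Gterm f) (fun=> 1)).
have [//|h' sh' eh'] := @expansion_nat _ _ g (fun=> 1) (fibre_sum (Gterm f) (fun=> 1)).
  by rewrite efg.
rewrite -[f]cat_1l -[g]cat_1l -er -!cat_A eh eh'.
by rewrite (linear_coherence sh sh').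
Qed.

End FreeStructure.

Theorem mainTheorem7 (P : Type) : faithful (G P).
Proof.
move=> A B f g; rewrite /= /Garr => /Gterm_faithful e.
by rewrite -[f]arrow_ofK -[g]arrow_ofK; apply/arrow_ofP.
Qed.
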